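(* Let $r\ge 2$ and $k\ge 1$ be integers, and let $F$ be a graph such that $\mathrm{ex}(n,F)=e(T_{n,r})+O(1)$ (i.e. $|\mathrm{ex}(n,F)-e(T_{n,r})|$ is bounded by a constant independent of $n$). Then there is $n_0$ such that for all $n\ge n_0$ the following holds: if $G$ is an $n$-vertex $kF$-free graph with the maximum possible number of edges (i.e. $e(G)=\mathrm{ex}(n,kF)$), then $G= K_{k-1}\vee G'$ for some $G'\in \mathrm{EX}(n-k+1,F)$.
   Context: All graphs are simple. For a graph $F$, $\mathrm{ex}(n,F)$ is the maximum number of edges of an $n$-vertex graph containing no copy of $F$ (as a subgraph), and $\mathrm{EX}(n,F)$ is the set of $n$-vertex $F$-free graphs with exactly $\mathrm{ex}(n,F)$ edges. $kF$ denotes the disjoint union of $k$ copies of $F$. $T_{n,r}$ is the Turán graph, the complete $r$-partite graph on $n$ vertices with part sizes as equal as possible; $e(\cdot)$ denotes the number of edges. $K_{m}$ is the complete graph on $m$ vertices ($K_0$ is the empty graph), and $G\vee H$ (the join) is obtained from the disjoint union of $G$ and $H$ by adding all edges between $V(G)$ and $V(H)$. *)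

(* Defs.v *)
From mathcomp Require Import all_boot.
Set Implicit Arguments. Unset Strict Implicit. Unset Printing Implicit Defensive.

Definition simpleb (V : finType) (g : rel V) : bool :=
  [forall x, ~~ g x x] && [forall x, [forall y, g x y == g y x]].

Definition contains (VF : finType) (F : rel VF) (V : finType) (g : rel V) : bool :=
  [exists f : {ffun VF -> V},
     injectiveb f && [forall x, [forall y, F x y ==> g (f x) (f y)]]].

Definition edges (n : nat) (g : rel 'I_n) : nat :=
  #|[set p : 'I_n * 'I_n | (p.1 < p.2) && g p.1 p.2]|.

Definition ffrel (n : nat) (g : {ffun 'I_n * 'I_n -> bool}) : rel 'I_n :=
  fun x y => g (x, y).

(* ex(n,F): max number of edges of an n-vertex F-free simple graph
   (every simple graph on 'I_n is ffrel g for some finite function g) *)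
Definition ex (VF : finType) (F : rel VF) (n : nat) : nat :=
  \max_(g : {ffun 'I_n * 'I_n -> bool} |
          simpleb (ffrel g) && ~~ contains F (ffrel g)) edges (ffrel g).

(* Turán graph T_{n,r}: parts are residue classes mod r (sizes as equal as possible) *)
Definition turan (n r : nat) : rel 'I_n := fun x y => (x %% r) != (y %% r).

Definition copies (k : nat) (VF : finType) (F : rel VF) : rel ('I_k * VF) :=
  fun a b => (a.1 == b.1) && F a.2 b.2.
Arguments turan : clear implicits.
Arguments copies k {VF} F.

(* Main.v *)
Require Import Defs.
From mathcomp Require Import all_boot zify.
Set Implicit Arguments. Unset Strict Implicit. Unset Printing Implicit Defensive.

(* The hypothesis makes ex(n,F) = (r-1)n^2/(2r) + O(1), and since the cone K_1 v T_{n-1,r}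
   has about n/r edges more than that, F embeds in such a cone.  Let G be extremal for
   (k+1)F, k >= 1.  Deleting at most k disjoint copies of F leaves an F-free graph, which is
   too sparse unless some deleted vertex v has degree at least (1 - 1/r + eps)n.  For every
   bounded set W avoiding v, G - W still contains F: otherwise G - W, being F-free and of
   nearly Turan density, has after the deletion of boundedly many vertices minimum degree
   close to (1 - 1/r)n; then the neighbourhood of v is dense enough to contain a complete
   r-partite graph with large parts (Erdos-Stone, minimum degree version), hence a cone,
   hence F.  So G - v is kF-free, and ex(n,(k+1)F) >= n - 1 + ex(n-1,kF) forces v to be
   adjacent to everything and G - v to be extremal for kF.  Induct on k. *)

(** * Embeddings, degrees and edge counts relative to a vertex subset *)

Definition embeds (VF V : finType) (F : rel VF) (g : rel V) (A : {set V}) : Prop :=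
  exists f : VF -> V,
    [/\ injective f, forall x y, F x y -> g (f x) (f y) & forall x, f x \in A].

Definition nb (V : finType) (g : rel V) (A : {set V}) (x : V) : nat :=
  \sum_(y in A) g x y.

(** Counts ordered adjacent pairs, hence twice the edges induced on [A] when [g] is a simple
    graph. *)
Definition vol (V : finType) (g : rel V) (A : {set V}) : nat :=
  \sum_(x in A) nb g A x.

Lemma containsP (VF V : finType) (F : rel VF) (g : rel V) :
  reflect (embeds F g setT) (contains F g).
Proof.
apply: (iffP existsP) => [[f /andP[/injectiveP fI /'forall_forallP fF]]|[f [fI fF _]]].
  by exists f; split => // x y; apply/implyP.
exists [ffun x => f x]; apply/andP; split.
  by apply/injectiveP => x y; rewrite !ffunE => /fI.
by apply/'forall_forallP => x y; rewrite !ffunE; apply/implyP/fF.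
Qed.

Lemma embedsS (VF V : finType) (F : rel VF) (g : rel V) (A B : {set V}) :
  A \subset B -> embeds F g A -> embeds F g B.
Proof. by move=> /subsetP sAB [f [fI fF fA]]; exists f; split=> // x; apply: sAB. Qed.

Lemma embeds_comp (V1 V2 V3 : finType) (g1 : rel V1) (g2 : rel V2) (g3 : rel V3)
    (A : {set V2}) (B : {set V3}) (h : V2 -> V3) :
  {in A &, injective h} -> {in A &, forall x y, g2 x y -> g3 (h x) (h y)} ->
  {in A, forall x, h x \in B} -> embeds g1 g2 A -> embeds g1 g3 B.
Proof.
move=> hI hg hB [f [fI fg fA]]; exists (h \o f); split=> /=.
- by move=> x y /hI e; apply/fI/e.
- by move=> x y /fg; apply: hg.
- by move=> x; apply: hB.
Qed.

Lemma nb_card (V : finType) (g : rel V) (A : {set V}) (x : V) :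
  nb g A x = #|[set y in A | g x y]|.
Proof.
rewrite /nb -sum1_card [RHS]big_mkcond [LHS]big_mkcond; apply: eq_bigr => y _.
by rewrite inE; case: (y \in A); case: (g x y).
Qed.

Lemma nbS (V : finType) (g : rel V) (A B : {set V}) (x : V) :
  A \subset B -> nb g A x <= nb g B x.
Proof.
move=> /subsetP sAB; rewrite !nb_card; apply/subset_leq_card/subsetP => y.
by rewrite !inE => /andP[/sAB->].
Qed.

Lemma nb_le (V : finType) (g : rel V) (A : {set V}) (x : V) : nb g A x <= #|A|.
Proof. by rewrite nb_card subset_leq_card //; apply/subsetP=> y; rewrite inE => /andP[]. Qed.

Lemma nb_le_D (V : finType) (g : rel V) (A B : {set V}) (x : V) :
  nb g A x <= nb g B x + #|A :\: B|.
Proof.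
rewrite !nb_card -(cardsID B) leq_add // subset_leq_card //; apply/subsetP => y.
  by rewrite !inE => /andP[/andP[_ ->] ->].
by rewrite !inE => /andP[-> /andP[-> _]].
Qed.

Lemma vol_imset (V V' : finType) (h : V' -> V) (g : rel V) (A : {set V'}) :
  injective h -> vol (fun x y => g (h x) (h y)) A = vol g (h @: A).
Proof.
move=> hI; rewrite /vol big_imset; last by move=> x y _ _; apply: hI.
apply: eq_bigr => x _; rewrite /nb big_imset //; by move=> ? ? _ _; apply: hI.
Qed.

Section SimpleGraph.
Variables (V : finType) (g : rel V).
Hypotheses (gI : irreflexive g) (gS : symmetric g).

Lemma vol_setD1 (A : {set V}) (a : V) :
  a \in A -> vol g A = vol g (A :\ a) + 2 * nb g A a.
Proof.
move=> aA; rewrite /vol (big_setD1 a) //=.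
under eq_bigr => x _ do rewrite /nb (big_setD1 a aA) /=.
rewrite big_split /= /nb [in LHS](big_setD1 a aA) [X in _ + 2 * X](big_setD1 a aA) /= gI.
under [X in _ + (X + _)]eq_bigr => x _ do rewrite gS.
lia.
Qed.

(** The vertices of [U] are deleted one at a time; each costs twice its degree in what is left of
    [A], which is at most its degree in [A]. *)
Lemma vol_setD (A U : {set V}) :
  vol g A <= vol g (A :\: U) + 2 * \sum_(u in U) nb g A u.
Proof.
move: {2}#|U| (leqnn #|U|) => m; elim: m U => [|m IH] U.
  by rewrite leqn0 cards_eq0 => /eqP->; rewrite setD0 leq_addr.
have [->|[u uU]] := set_0Vmem U; first by rewrite setD0 leq_addr.
rewrite (cardsD1 u) uU ltnS (big_setD1 u) //= => /IH h; apply: leq_trans h _.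
have -> : A :\: U = (A :\: (U :\ u)) :\ u by rewrite setDDl setUC setD1K.
have [uA|uA] := boolP (u \in A :\: (U :\ u)).
  have := nbS g u (subsetDl A (U :\ u)).
  rewrite (vol_setD1 uA); lia.
have -> : A :\: (U :\ u) :\ u = A :\: (U :\ u).
  by apply/setDidPl; rewrite disjoint_sym disjoints1.
lia.
Qed.
End SimpleGraph.

(** * Edge counts and extremal numbers *)

Lemma vol_edges (n : nat) (g : rel 'I_n) :
  irreflexive g -> symmetric g -> vol g setT = 2 * edges g.
Proof.
move=> gI gS; rewrite /edges -sum1_card big_mkcond /=.
have -> : \sum_i (if i \in [set p : 'I_n * 'I_n | (p.1 < p.2) && g p.1 p.2] then 1 else 0)
  = \sum_(x < n) \sum_(y < n) ((x < y) && g x y).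
  rewrite pair_big /=; apply: eq_bigr => -[x y] _ /=; rewrite inE /=; by case: ifP.
rewrite mul2n -addnn {2}exchange_big -big_split /vol /nb.
apply: eq_big => [x|x _]; first by rewrite inE.
rewrite -big_split; apply: eq_big => [y|y _] /=; first by rewrite inE.
rewrite [g y x]gS; case: ltngtP => //=; rewrite ?addn0 //.
by move=> /val_inj->; rewrite gI.
Qed.

Lemma edges_ex (VF : finType) (F : rel VF) (n : nat) (g : rel 'I_n) :
  irreflexive g -> symmetric g -> ~ embeds F g setT -> edges g <= ex F n.
Proof.
move=> gI gS gF; pose g' := [ffun p : 'I_n * 'I_n => g p.1 p.2].
have gE : ffrel g' =2 g by move=> x y; rewrite /ffrel ffunE.
have -> : edges g = edges (ffrel g').
  by apply: eq_card => p; rewrite !inE gE.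
apply: (@leq_bigmax_cond _ _ (fun g => edges (ffrel g)) g').
apply/andP; split.
  apply/andP; split; first by apply/forallP=> x; rewrite gE gI.
  by apply/'forall_forallP=> x y; rewrite !gE gS eqxx.
apply/containsP => -[f [fI fF fA]]; apply: gF; exists f; split=> // x y /fF.
by rewrite gE.
Qed.

(** [ex] only speaks of hosts on ordinals, so the graph induced on [A] is renumbered through
    [enum_val]. *)
Lemma vol_ex (VF V : finType) (F : rel VF) (g : rel V) (A : {set V}) :
  irreflexive g -> symmetric g -> ~ embeds F g A -> vol g A <= 2 * ex F #|A|.
Proof.
move=> gI gS gF; pose h : 'I_#|A| -> V := enum_val.
have hI : injective h by apply: enum_val_inj.
have hA : h @: setT = A.
  apply/setP => y; apply/imsetP/idP => [[x _ ->]|yA]; first exact: enum_valP.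
  by exists (enum_rank_in yA y) => //; rewrite /h enum_rankK_in.
rewrite -{1}hA -(vol_imset _ _ hI) vol_edges ?leq_mul2l //=.
apply: edges_ex => //; apply: contra_not gF.
apply: (@embeds_comp _ _ _ _ _ _ setT _ h) => // [x y _ _|x _]; first exact: hI.
by rewrite -hA imset_f.
Qed.

(** An edge of [F] makes the edgeless graph [F]-free, so the maximum defining [ex] ranges over a
    nonempty family. *)
Lemma ex_attained (VF : finType) (F : rel VF) (n : nat) (x0 y0 : VF) :
  F x0 y0 -> exists g : rel 'I_n,
    [/\ irreflexive g, symmetric g, ~ embeds F g setT & edges g = ex F n].
Proof.
move=> F0; rewrite /ex.
set P := fun g : {ffun 'I_n * 'I_n -> bool} => simpleb (ffrel g) && ~~ contains F (ffrel g).
have [|g /andP[/andP[/forallP gI /'forall_forallP gS] /containsP gF] ->] :=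
  @eq_bigmax_cond _ P (fun g => edges (ffrel g)).
  apply/card_gt0P; exists [ffun=> false]; apply/andP; split.
    apply/andP; split; first by apply/forallP=> x; rewrite /ffrel ffunE.
    by apply/'forall_forallP=> x y; rewrite /ffrel !ffunE.
  by apply/containsP => -[f [_ /(_ _ _ F0)]]; rewrite /ffrel ffunE.
exists (ffrel g); split=> // [x|x y]; first exact/negbTE/gI.
exact/eqP/gS.
Qed.

(** * Complete multipartite subgraphs from a minimum degree condition *)

Lemma subset_of_card (V : finType) (A : {set V}) (t : nat) :
  t <= #|A| -> exists2 B : {set V}, B \subset A & #|B| = t.
Proof.
move=> /card_geqP[s [sU sz sA]]; exists [set x in s].
  by apply/subsetP => x; rewrite inE => /sA.
by rewrite cardsE (card_uniqP sU).
Qed.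

Lemma pigeonhole_fiber (V W : finType) (phi : V -> W) (A : {set V}) (P : {set W}) (t : nat) :
  {in A, forall x, phi x \in P} -> t * #|P| < #|A| ->
  exists w, t < #|[set x in A | phi x == w]|.
Proof.
move=> hP hA; apply/existsP; apply: contraLR hA => /existsPn h; rewrite -leqNgt.
rewrite -sum1_card (partition_big phi (mem P)) //= mulnC -sum_nat_const leq_sum // => w _.
by rewrite sum1dep_card leqNgt.
Qed.

(* Each vertex of [A] has at most [(1 - 1/q) / s * #|A|] non-neighbours in [A],
   itself included. *)
Lemma erdos_stone_min_degree (s q t : nat) : 0 < q -> 0 < t ->
  exists N : nat, forall (V : finType) (g : rel V) (A : {set V}),
  symmetric g -> N <= #|A| ->
  {in A, forall a, q * (s * #|[set y in A | ~~ g a y]|) + #|A| <= q * #|A|} ->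
  exists B : nat -> {set V},
    [/\ forall i, i <= s -> B i \subset A, forall i, i <= s -> #|B i| = t &
        forall i j x y, i <= s -> j <= s -> i != j -> x \in B i -> y \in B j -> g x y].
Proof.
move=> q0; elim: s t => [|s IH] t t0.
  exists t => V g A gS /subset_of_card[B sBA cB] _; exists (fun=> B); split=> //.
  by move=> i j x y; rewrite !leqn0 => /eqP-> /eqP->.
(* The induction hypothesis is used with classes of size 2qt, so that [t] is a small enough fraction
   of them in the count of good vertices. *)
have T0 : 0 < 2 * q * t by rewrite !muln_gt0 q0.
have [N HN] := IH _ T0; set T := 2 * q * t in T0 HN.
exists (maxn N (2 * q * (t * 2 ^ (s.+1 * T)).+1)) => V g A gS.
rewrite geq_max => /andP[/HN HA leA] hA.
have [|B [BA cB gB]] := HA g gS.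
  move=> a /hA h; apply: leq_trans h; rewrite leq_add2r !leq_mul2l leq_mul2r leqnSn.
  by rewrite !orbT.
pose nonadj := \sum_(a in A) \sum_(i < s.+1) \sum_(b in B i) ~~ g b a.
(* Each [b] in a class misses at most (1 - 1/q)/(s+1) of [A], and the s+1 classes have [T] elements
   each, so [nonadj] is at most (1 - 1/q) T |A|. *)
have nonadj_le : q * nonadj + T * #|A| <= T * (q * #|A|).
  have : q * (s.+1 * nonadj) + s.+1 * (T * #|A|) <= s.+1 * (T * (q * #|A|)).
    have -> : nonadj = \sum_(i < s.+1) \sum_(b in B i) #|[set y in A | ~~ g b y]|.
      rewrite /nonadj exchange_big; apply: eq_bigr => i _; rewrite exchange_big.
      apply: eq_bigr => b _; rewrite -sum1_card big_mkcond [RHS]big_mkcond.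
      by apply: eq_bigr => y _; rewrite inE; case: (y \in A); case: (g b y).
    have sE (X : nat) : s.+1 * (T * X) = \sum_(i < s.+1) \sum_(b in B i) X.
      rewrite -{1}[s.+1]card_ord -sum_nat_const.
      by apply: eq_bigr => i _; rewrite sum_nat_const cB ?leq_ord.
    rewrite ![s.+1 * (T * _)]sE !big_distrr -big_split leq_sum //= => i _.
    rewrite !big_distrr -big_split leq_sum //= => b bB; apply: hA.
    by apply: (subsetP (BA i _)) bB; rewrite -ltnS.
  nia.
pose good := [set a in A | [forall i : 'I_s.+1, t <= #|[set b in B i | g b a]|]].
(* A vertex of [A] outside [good] misses more than T - t elements of some class; comparing with
   [nonadj_le] leaves at least |A|/(2q) good vertices. *)
have good_large : #|A| <= 2 * q * #|good|.
  have : #|A :\: good| * (T - t) <= nonadj.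
    rewrite -sum_nat_const /nonadj [X in _ <= X](big_setID good) /=.
    apply: leq_trans (leq_addl _ _); apply: leq_sum => a; rewrite !inE.
    case/andP => h aA; move: h; rewrite aA /= => /forallPn[i]; rewrite -ltnNge => h.
    rewrite (bigD1 i) //=; apply: leq_trans (leq_addr _ _).
    have := cB i (leq_ord i); rewrite -(cardsID [set b | g b a]).
    have -> : B i :&: [set b | g b a] = [set b in B i | g b a].
      by apply/setP => b; rewrite !inE.
    have -> : #|B i :\: [set b | g b a]| = \sum_(b in B i) ~~ g b a.
      rewrite -sum1_card big_mkcond [RHS]big_mkcond.
      by apply: eq_bigr => b _; rewrite !inE; case: (b \in B i); case: (g b a).
    lia.
  have : #|A| = #|good| + #|A :\: good|.
    rewrite -(cardsID good A); rewrite (setIidPr _) //; apply/subsetP => a.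
    by rewrite inE => /andP[].
  move: nonadj_le; rewrite /T; clear -q0 t0; nia.
pose U := \bigcup_(i < s.+1) B i.
have cU : #|U| <= s.+1 * T.
  apply: (@leq_trans (\sum_(i < s.+1) #|B i|)).
    rewrite /U; elim/big_rec2: _ => [|i m X _ h]; rewrite ?cards0 //.
    by apply: leq_trans (leq_card_setU _ _) _; rewrite leq_add2l.
  rewrite (eq_bigr (fun=> T)) ?sum_nat_const ?card_ord // => i _.
  by rewrite cB ?leq_ord.
(* Good vertices are sorted by their neighbourhood in [U]. There are boundedly many such traces, so
   [t] good vertices share one trace [X]; they form the new class [D]. *)
pose phi a := [set b in U | g b a].
have [||X /ltnW/subset_of_card[D DX cD]] := @pigeonhole_fiber _ _ phi good (powerset U) t.
- by move=> a _; rewrite inE; apply/subsetP => b; rewrite inE => /andP[].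
- rewrite card_powerset.
  have : t * 2 ^ #|U| <= t * 2 ^ (s.+1 * T) by rewrite leq_mul2l leq_exp2l ?cU ?orbT.
  clear -leA good_large q0; nia.
have [a0 a0D] : exists a, a \in D by apply/card_gt0P; rewrite cD.
have a0P : (a0 \in good) && (phi a0 == X).
  by have := subsetP DX _ a0D; rewrite in_set.
(* Goodness gives [X] at least [t] elements in every old class, so each can be shrunk to [t] common
   neighbours of [D]. *)
have hB' i : exists B' : {set V}, i <= s -> [/\ B' \subset B i :&: X & #|B'| = t].
  have [les|] := leqP i s; last by exists set0.
  have [|B' sB' cB'] := @subset_of_card _ (B i :&: X) t; last by exists B'.
  case/andP: a0P; rewrite inE => /andP[_ /forallP/(_ (inord i))].
  rewrite inordK // => h /eqP <-; apply: leq_trans h _; apply/subset_leq_card/subsetP => b.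
  rewrite !inE => /andP[bB ->]; rewrite bB /= andbT; apply/bigcupP.
  by exists (inord i) => //; rewrite inordK.
have [B' HB'] := fin_all_exists (fun i : 'I_s.+1 => hB' i).
pose B2 i := if i <= s then B' (inord i) else D.
have B2P i : i <= s -> B2 i \subset B i :&: X /\ #|B2 i| = t.
  by move=> les; rewrite /B2 les; have := HB' (inord i); rewrite inordK // => /(_ les)[].
have B2D : B2 s.+1 = D by rewrite /B2 ltnn.
have DP i x y : i <= s -> x \in B2 i -> y \in D -> g x y.
  move=> /B2P[/subsetP sB _] /sB /setIP[_ xX] /(subsetP DX).
  by rewrite inE => /andP[_ /eqP yX]; move: xX; rewrite -yX inE => /andP[].
exists B2; split=> [i|i|i j x y].
- rewrite leq_eqVlt => /orP[/eqP->|/[dup] les /B2P[sB _]].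
    by rewrite B2D; apply/subsetP=> a /(subsetP DX); rewrite !inE -andbA => /and3P[].
  exact: subset_trans sB (subset_trans (subsetIl _ _) (BA _ les)).
- by rewrite leq_eqVlt => /orP[/eqP->|/B2P[]//]; rewrite B2D.
- rewrite leq_eqVlt => /orP[/eqP->|les]; rewrite leq_eqVlt => /orP[/eqP->|lejs];
    rewrite ?eqxx ?B2D //.
  + by move=> _ xD yB; rewrite gS; apply: DP yB xD.
  + by move=> _; apply: DP.
  + move=> ij xB yB; apply: (gB i j) => //.
      by have [/subsetP/(_ _ xB)/setIP[]] := B2P _ les.
    by have [/subsetP/(_ _ yB)/setIP[]] := B2P _ lejs.
Qed.

(** * Edge count of the Turán graph *)

Lemma sum_modn_eq (n a r : nat) : a < r ->
  \sum_(x < n) (x %% r == a) = (n + (r.-1 - a)) %/ r.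
Proof.
move=> ar; elim: n => [|n IH]; first by rewrite big_ord0 divn_small //; lia.
rewrite big_ord_recr /= IH addSn divnS; last by lia.
rewrite addnC; congr (nat_of_bool _ + _).
have -> : (n + (r.-1 - a)).+1 = n %/ r * r + (n %% r + r - a).
  by have := divn_eq n r; lia.
rewrite dvdn_addr ?dvdn_mull //.
have := ltn_pmod n (leq_ltn_trans (leq0n a) ar).
move: (n %% r) => b br.
apply/eqP/idP => [->|]; first by have -> : a + r - a = r by lia.
by move/dvdnP=> [[|[|m]]]; rewrite ?mul0n ?mul1n ?mulSn; lia.
Qed.

(** The new vertex [n] misses exactly the [n %/ r] earlier vertices of its residue class. *)
Lemma edges_turanS (n r : nat) : 0 < r ->
  edges (turan n.+1 r) + n %/ r = edges (turan n r) + n.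
Proof.
move=> r0; have edgesE m : edges (turan m r) =
    \sum_(x < m) \sum_(y < m) ((x < y) && (x %% r != y %% r)).
  rewrite /edges -sum1_card big_mkcond pair_big /=; apply: eq_bigr => -[x y] _ /=.
  by rewrite inE /turan /=; case: ifP.
rewrite !edgesE big_ord_recr /= [X in _ + X + _]big1 ?addn0; last first.
  by move=> y _; rewrite ltnNge -ltnS ltn_ord.
under eq_bigr => x _ do rewrite big_ord_recr /= ltn_ord /=.
rewrite big_split /= -addnA; congr (_ + _).
have -> : n %/ r = \sum_(x < n) (x %% r == n %% r).
  rewrite sum_modn_eq ?ltn_pmod //.
  have := divn_eq n r; have := ltn_pmod n r0.
  move: (n %/ r) (n %% r) => q b br ->.
  have -> : q * r + b + (r.-1 - b) = q * r + r.-1 by lia.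
  by rewrite divnMDl // divn_small ?addn0 //; lia.
rewrite -big_split /= (eq_bigr (fun=> 1)) ?sum1_card ?card_ord // => x _.
by case: eqP.
Qed.

(** Induction through [edges_turanS]. The correction term is bounded in terms of [r] alone, so the
    edge count is (r-1)n^2/(2r) up to a constant. *)
Lemma edges_turan (n r : nat) : 0 < r ->
  2 * r * edges (turan n r) + (n %% r) * (r - n %% r) = (r - 1) * n ^ 2.
Proof.
move=> r0; elim: n => [|n IH].
  have -> : edges (turan 0 r) = 0 by apply: eq_card0 => -[[]].
  by rewrite mod0n mul0n !muln0.
have h : r * edges (turan n.+1 r) + n = r * (edges (turan n r) + n) + n %% r.
  by rewrite -edges_turanS // mulnDr -addnA; congr (_ + _); have := divn_eq n r; lia.
have := ltn_pmod n r0; rewrite modnS; case: ifP => [rn|_].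
  have : n %% r = r.-1.
    move: rn; rewrite {1}(divn_eq n r) -addnS dvdn_addr ?dvdn_mull // => /(dvdn_leq (ltn0Sn _)).
    by have := ltn_pmod n r0; lia.
  move: (edges _) (edges _) (n %% r) h IH => e e' b h IH h1 _; subst b.
  have [c h2] : exists c, r = c.+1 by exists r.-1; lia.
  by subst r; rewrite /= !subSS !subn0 subSnn in h IH *; lia.
move: (edges _) (edges _) (n %% r) h IH => e e' b h IH br.
have [c h2] : exists c, r = b + c.+1 by exists (r - b.+1); lia.
subst r; have -> : b + c.+1 - b.+1 = c by lia.
have h3 : b + c.+1 - b = c.+1 by lia.
have h4 : b + c.+1 - 1 = b + c by lia.
rewrite h3 h4 in IH; rewrite h4; lia.
Qed.

(** * Cones K_1 v T_{m-1,r} over Turán graphs, with vertex 0 as apex *)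

Definition cone (m r : nat) : rel 'I_m :=
  fun x y => (x != y) && [|| val x == 0, val y == 0 | x %% r != y %% r].

(** In the Turán graph vertex 0 misses the C+1 vertices r, 2r, ..., r(C+1); the cone adds these
    edges, and its order is chosen to make the gain exceed [C]. *)
Lemma edges_cone (r C : nat) : 0 < r ->
  edges (turan (r * C.+1).+1 r) + C < edges (@cone (r * C.+1).+1 r).
Proof.
move=> r0; rewrite -addnS /edges.
set ET := [set p | _ & turan _ _ _ _]; set EC := [set p | _ & cone _ _ _].
rewrite -(cardsID ET EC) leq_add //.
  apply/subset_leq_card/subsetP => -[x y]; rewrite !inE /= => /andP[xy xyr].
  by rewrite xy /cone -val_eqE /= neq_ltn xy /= [x %% r != _]xyr !orbT.
pose h (i : 'I_C.+1) : 'I_(r * C.+1).+1 * 'I_(r * C.+1).+1 := (ord0, inord (r * i.+1)).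
have hE i : val (h i).2 = r * i.+1 by rewrite /= inordK // ltnS leq_mul2l ltn_ord orbT.
have hI : injective h.
  move=> i j /(congr1 (fun p => val p.2)); rewrite !hE => /eqP.
  by rewrite eqn_pmul2l // eqSS => /eqP/val_inj.
rewrite -{1}[C.+1]card_ord -cardsT -(card_imset _ hI).
apply/subset_leq_card/subsetP => _ /imsetP[i _ ->]; rewrite !inE /turan hE /= mod0n.
have p : 0 < r * i.+1 by rewrite muln_gt0 r0.
by rewrite modnMr eqxx andbF /= p /cone -val_eqE hE /= ltn_eqF.
Qed.

Lemma embeds_cone (VF : finType) (F : rel VF) (r C : nat) : 0 < r ->
  (forall n, ex F n <= edges (turan n r) + C) -> embeds F (@cone (r * C.+1).+1 r) setT.
Proof.
move=> r0 hC; apply/containsP/contraT => /containsP nF.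
have := edges_cone C r0; rewrite ltnNge => /negP[].
apply: leq_trans (hC _); apply: edges_ex nF.
  by move=> x; rewrite /cone eqxx.
by move=> x y; rewrite /cone eq_sym orbCA [_ %% r == _]eq_sym.
Qed.

(** The apex goes to [v] and a vertex [x] to the entry of index [x] in class [x %% r]. Adjacent
    vertices have distinct images because [g] is irreflexive, and vertices of one class because
    their indices differ. *)
Lemma embeds_cone_blowup (VF V : finType) (F : rel VF) (g : rel V) (m r : nat)
    (A : {set V}) (v : V) (B : nat -> {set V}) :
  irreflexive g -> symmetric g -> 0 < r -> v \in A ->
  (forall i, i < r -> B i \subset A) -> (forall i, i < r -> #|B i| = m) ->
  (forall i x, i < r -> x \in B i -> g v x) ->
  (forall i j x y, i < r -> j < r -> i != j -> x \in B i -> y \in B j -> g x y) ->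
  embeds F (@cone m r) setT -> embeds F g A.
Proof.
move=> gI gS r0 vA BA cB gv gB.
pose f (x : 'I_m) := if val x == 0 then v else nth v (enum (B (x %% r))) x.
have mr (x : 'I_m) : x %% r < r by rewrite ltn_mod.
have fB (x : 'I_m) : val x != 0 -> f x \in B (x %% r).
  by move=> /negbTE x0; rewrite /f x0 -mem_enum mem_nth // -cardE cB.
have fg x y : cone r x y -> g (f x) (f y).
  case/andP=> xy h; have [x0|x0] := eqVneq (val x) 0.
    have y0 : val y != 0 by rewrite -x0 val_eqE eq_sym.
    by rewrite {1}/f x0 eqxx; apply: gv (fB _ y0).
  have [y0|y0] := eqVneq (val y) 0.
    by rewrite gS {1}/f y0 eqxx; apply: gv (fB _ x0).
  move: h; rewrite (negbTE x0) (negbTE y0) /= => xyr.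
  by apply: gB (fB _ x0) (fB _ y0).
apply: (@embeds_comp _ _ _ _ _ _ _ _ f) => [x y _ _ fxy|x y _ _|x _]; last first.
- by have [x0|x0] := eqVneq (val x) 0; [rewrite /f x0 eqxx | apply: (subsetP (BA _ _)) (fB _ x0)].
- exact: fg.
apply/eqP/negPn/negP => xy; have /negbT := gI (f x); rewrite {2}fxy.
case: (boolP (cone r x y)) => [/fg->//|].
rewrite /cone xy !negb_or negbK => /and3P[x0 y0 /eqP xyr] _.
move: fxy; rewrite /f (negbTE x0) (negbTE y0) xyr => /eqP.
by rewrite nth_uniq ?enum_uniq -?cardE ?cB // => /eqP/val_inj/eqP; rewrite (negbTE xy).
Qed.

(** * Quadratic growth of [ex F], and the edgeless case *)

Lemma ex_quadratic (VF : finType) (F : rel VF) (r C : nat) : 0 < r ->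
  (forall n, ex F n <= edges (turan n r) + C /\ edges (turan n r) <= ex F n + C) ->
  exists D, forall n, 2 * r * ex F n <= (r - 1) * n ^ 2 + D /\
                      (r - 1) * n ^ 2 <= 2 * r * ex F n + D.
Proof.
move=> r0 hC; exists (r * r + 2 * r * C) => n; have [h1 h2] := hC n.
have := edges_turan n r0; have := ltn_pmod n r0.
move: ((r - 1) * n ^ 2) (n %% r) (edges _) (ex F n) h1 h2 => X b e e' h1 h2 br <-.
have : b * (r - b) <= r * r by apply: leq_mul; lia.
nia.
Qed.

(** Every graph with at least |VF| vertices contains an edgeless [F], so the maximum is over an
    empty family and takes its default value 0. *)
Lemma ex_edgeless (VF : finType) (F : rel VF) (n : nat) :
  (forall x y, ~~ F x y) -> #|VF| <= n -> ex F n = 0.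
Proof.
move=> F0 n0; apply: big_pred0 => g; apply/negbTE; rewrite negb_and negbK.
apply/orP; right; apply/containsP; exists (fun x => widen_ord n0 (enum_rank x)); split=> //.
  by move=> x y /(congr1 val)/= /val_inj/enum_rank_inj.
by move=> x y; rewrite (negbTE (F0 x y)).
Qed.

Lemma embeds_dec (VF V : finType) (F : rel VF) (g : rel V) (A : {set V}) :
  decidable (embeds F g A).
Proof.
apply: (@decP _ [exists f : {ffun VF -> V}, [&& injectiveb f,
  [forall x, [forall y, F x y ==> g (f x) (f y)]] & [forall x, f x \in A]]]).
apply: (iffP existsP) => [[f /and3P[/injectiveP fI /'forall_forallP fF /forallP fA]]|].
  by exists f; split => // x y; apply/implyP.
move=> [f [fI fF fA]]; exists [ffun x => f x]; apply/and3P; split.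
- by apply/injectiveP => x y; rewrite !ffunE => /fI.
- by apply/'forall_forallP => x y; rewrite !ffunE; apply/implyP/fF.
- by apply/forallP => x; rewrite ffunE.
Qed.

(** * Minimum degree and vertices of large degree *)

Lemma card_nb_compl (V : finType) (g : rel V) (A : {set V}) (x : V) :
  nb g A x + #|[set y in A | ~~ g x y]| = #|A|.
Proof.
rewrite nb_card -(cardsID [set y | g x y] A).
by congr (_ + _); apply: eq_card => y; rewrite !inE // andbC.
Qed.

(* Deleting a vertex of degree less than [(1 - 1/r - 1/(r q)) * #|A|] raises the surplus
   [r * vol g A - (r - 1) * #|A| ^ 2] by at least [d]; the surplus never exceeds [D]. *)
Lemma min_degree_subset (V : finType) (g : rel V) (A0 : {set V}) (r q d h D l : nat)
    (A : {set V}) :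
  irreflexive g -> symmetric g -> 0 < r -> 0 < q ->
  (forall B : {set V}, B \subset A0 -> r * vol g B <= (r - 1) * #|B| ^ 2 + D) ->
  q * (d + r) <= 2 * h -> A \subset A0 -> h + l <= #|A| ->
  (r - 1) * #|A| ^ 2 + D < r * vol g A + l * d ->
  exists2 B : {set V}, B \subset A /\ #|A| <= #|B| + l &
    {in B, forall a, r * q * #|[set y in B | ~~ g a y]| <= q.+1 * #|B|}.
Proof.
move=> gI gS r0 q0 hD qdh; elim: l A => [|l IH] A sA hA surplus.
  by have := hD A sA; lia.
have [/forallP good|/forallPn[a]] := boolP [forall a, (a \in A) ==>
    (r * q * #|[set y in A | ~~ g a y]| <= q.+1 * #|A|)].
  by exists A; [split; rewrite ?leq_addr | move=> a aA; have /implyP/(_ aA) := good a].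
rewrite negb_imply -ltnNge => /andP[aA bad].
have cA : #|A| = #|A :\ a|.+1 by rewrite (cardsD1 a) aA.
have sAa := subsetDl A [set a].
case: (IH (A :\ a)) => [|||B [sB cB] HB].
- exact: subset_trans sAa sA.
- by lia.
- have := card_nb_compl g A a; move: bad surplus; rewrite (vol_setD1 gI gS aA).
  move: (nb g A a) #|[set y in A | _]| (vol g _) => x y v bad.
  have [r' rE] : exists r', r = r'.+1 by exists r.-1; lia.
  subst r; move: hA qdh bad; rewrite cA subn1 /=; move: #|_ :\ a| => b hA qdh bad surplus xy.
  (* Here [x] is the degree of [a] and |A| = b+1. Deleting [a] lowers r vol by 2rx and (r-1)|A|^2 by
     (r-1)(2b+1); the second loss exceeds the first by at least [d]. *)
  have : q * (2 * (r'.+1 * x) + d) <= q * (r' * (2 * b + 1)).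
    have : q * r'.+1 * (x + y) = q * r'.+1 * b.+1 by rewrite xy.
    by lia.
  rewrite leq_pmul2l //; lia.
- by exists B => //; split; [apply: subset_trans sB sAa | lia].
Qed.

(** Heavy means degree at least (1 - 1/r + 1/(rM))|V|. The neighbourhood of such a vertex is large
    enough for the minimum degree of an almost spanning subgraph to force [r] complete classes
    inside it. *)
Lemma heavy_vertex_embeds (VF : finType) (F : rel VF) (r m K M D : nat) :
  0 < r -> 0 < m -> 0 < M ->
  (forall n, 2 * r * ex F n <= (r - 1) * n ^ 2 + D) -> embeds F (@cone m r) setT ->
  exists N0 : nat, forall (V : finType) (g : rel V) (v : V) (W : {set V}),
    irreflexive g -> symmetric g -> N0 <= #|V| ->
    (r - 1) * #|V| ^ 2 <= r * vol g setT ->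
    ((r - 1) * M).+1 * #|V| <= r * M * nb g setT v ->
    #|W| <= K -> v \notin W -> embeds F g (~: W).
Proof.
move=> r0 m0 M0 hD Fcone; pose R := (r - 1) * M; pose q := 2 * R.+1.
have q0 : 0 < q by rewrite muln_gt0.
have [NE HE] := @erdos_stone_min_degree (r - 1) q m q0 m0.
pose l := q * (2 * r * K + 2).
exists (2 * (K + l) + q * r + (2 * r * K + 2) * q + D.+1 + r * M * (NE + q * (K + l))).
move=> V g v W gI gS; set N := #|V| => hN dense heavy WK vW.
have [//|nF] := embeds_dec F g (~: W); exfalso.
have cW : #|W| + #|~: W| = N by rewrite cardsC.
have volW : r * vol g setT <= r * vol g (~: W) + 2 * r * K * N.
  have := vol_setD gI gS setT W; rewrite setTD.
  have : \sum_(u in W) nb g setT u <= K * N.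
    apply: (@leq_trans (\sum_(u in W) N)); last by rewrite sum_nat_const leq_mul2r WK orbT.
    by apply: leq_sum => u _; rewrite (leq_trans (nb_le _ _ _)) ?cardsT.
  by clear -r0; nia.
have sparse (B : {set V}) : B \subset ~: W -> r * vol g B <= (r - 1) * #|B| ^ 2 + D.
  move=> sB; apply: leq_trans (hD _); rewrite mulnAC mulnC leq_mul2r; apply/orP; right.
  by apply: vol_ex => //; apply: contra_not nF; apply: embedsS.
have [|||A [sA cA] HA] := @min_degree_subset _ g (~: W) r q (N %/ q) (N - K - l) D l (~: W)
    gI gS r0 q0 sparse _ (subxx _).
- by have := leq_trunc_div N q; lia.
- by lia.
- have : (2 * r * K + 2) * N <= l * (N %/ q) + (2 * r * K + 2) * q.
    apply: leq_trans (leq_mul (leqnn _) (ltnW (ltn_ceil N q0))) _.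
    by rewrite /l; move: (2 * r * K + 2) (N %/ q) => a b; lia.
  have : (r - 1) * #|~: W| ^ 2 <= (r - 1) * N ^ 2.
    by rewrite leq_mul2l leq_exp2r // -cW leq_addl orbT.
  lia.
pose B := [set y in A | g v y].
have sBA : B \subset A by apply/subsetP => y; rewrite inE => /andP[].
have cB : nb g setT v <= #|B| + (K + l).
  rewrite -nb_card; apply: leq_trans (nb_le_D _ _ A _) _; rewrite leq_add2l setTD.
  by have := cardsC A; rewrite -/N; lia.
have rMB : R.+1 * N <= r * M * #|B| + r * M * (K + l).
  by apply: leq_trans heavy _; rewrite -mulnDr leq_mul2l cB orbT.
have rM0 : 0 < r * M by rewrite muln_gt0 r0.
case: (HE V g B gS).
- rewrite -(leq_pmul2l rM0).
  have : r * M * NE + r * M * (K + l) <= N by move: hN; rewrite !mulnDr /q; lia.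
  lia.
- move=> b bB.
  have : #|[set y in B | ~~ g b y]| <= #|[set y in A | ~~ g b y]|.
    apply/subset_leq_card/subsetP => y; rewrite !inE => /andP[/andP[-> _] ->] //.
  have := HA b (subsetP sBA _ bB).
  move: #|[set y in A | _]| #|[set y in B | _]| => a n' h1 h2.
  have cAN : #|A| <= N by rewrite max_card.
  rewrite -(leq_pmul2l rM0).
  have : R * (r * q * n') <= R * (q.+1 * N).
    rewrite leq_mul2l; apply/orP; right; apply: leq_trans (_ : r * q * a <= _).
      by rewrite leq_mul2l h2 orbT.
    by apply: leq_trans h1 _; rewrite leq_mul2l cAN orbT.
  have -> : R * (r * q * n') = r * M * (q * ((r - 1) * n')) by rewrite /R; lia.
  have : q * (r * M * (K + l)) <= N.
    apply: leq_trans (leq_trans (leq_addl _ _) hN).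
    by rewrite mulnCA leq_mul2l leq_addl orbT.
  move: rMB; rewrite /q [r * M * (_ + #|B|)]mulnDr [r * M * (_ * #|B|)]mulnCA.
  move: (r * M * #|B|) (r * M * (K + l)) (r * M * (2 * _ * _)) => X Y Z rMB h3 h4.
  (* The factor [(2 * R).+1] is q - 1. *)
  have : (2 * R).+1 * (R.+1 * N) <= (2 * R).+1 * (X + Y) by rewrite leq_mul2l rMB orbT.
  lia.
- move=> Bs [sBs cBs gBs]; apply: nF.
  have rE i : i < r -> i <= r - 1 by lia.
  have sBW i : i < r -> Bs i \subset ~: W.
    by move=> /rE/sBs h; apply: subset_trans h (subset_trans sBA sA).
  apply: (@embeds_cone_blowup _ _ F g m r (~: W) v Bs gI gS r0) => //.
  + by rewrite inE.
  + by move=> i /rE/cBs.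
  + by move=> i x /rE/sBs/subsetP h /h; rewrite inE => /andP[].
  + by move=> i j x y /rE ir /rE; apply: gBs.
Qed.

(** If every vertex of [U] had degree below (1 - 1/r + 1/(r(K+1)))|V|, then r vol would be at most
    (r-1)|V|^2 + 2K|V|/(K+1) + O(1), short of the assumed linear term 2|V|. *)
Lemma heavy_vertex_exists (VF : finType) (F : rel VF) (r K D : nat) :
  0 < r -> (forall n, 2 * r * ex F n <= (r - 1) * n ^ 2 + D) ->
  exists N0 : nat, forall (V : finType) (g : rel V) (U : {set V}),
    irreflexive g -> symmetric g -> N0 <= #|V| ->
    (r - 1) * #|V| ^ 2 + 2 * #|V| <= r * vol g setT + D ->
    #|U| <= K -> ~ embeds F g (~: U) ->
    exists v, ((r - 1) * K.+1).+1 * #|V| <= r * K.+1 * nb g setT v.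
Proof.
move=> r0 hD; exists (K.+1 * (2 * D) + K.+1 * ((r - 1) * K ^ 2)).+1.
move=> V g U gI gS; set N := #|V| => hN dense UK nF.
apply/existsP; apply: contraT => /existsPn light; exfalso.
have cU : #|U| + #|~: U| = N by rewrite cardsC.
have h1 : r * vol g (~: U) <= (r - 1) * #|~: U| ^ 2 + D.
  apply: leq_trans (hD _); rewrite mulnAC mulnC leq_mul2r; apply/orP; right.
  exact: vol_ex.
have h2 : r * K.+1 * \sum_(u in U) nb g setT u <= #|U| * (((r - 1) * K.+1).+1 * N).
  rewrite big_distrr -sum_nat_const leq_sum //= => u _.
  by have := light u; rewrite -ltnNge => /ltnW.
have := vol_setD gI gS setT U; rewrite setTD.
move: (vol g _) (vol g _) (\sum_(_ in _) _) #|U| #|~: U| h1 h2 dense UK cU hN => v v' S u a.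
move: (r - 1) (N) => r' n; clear light.
move=> h1 h2 dense uK cU hN h3.
have : K.+1 * (r' * n ^ 2 + 2 * n) <= K.+1 * (r' * a ^ 2 + 2 * D) + 2 * (u * ((r' * K.+1).+1 * n)).
  have e1 := leq_mul (leqnn K.+1) dense.
  have e2 := leq_mul (leqnn K.+1) h1.
  have e3 := leq_mul (leqnn (r * K.+1)) h3.
  lia.
(* The expansion of a^2 = (n-u)^2, arranged without subtraction. *)
have e1 : K.+1 * r' * (n ^ 2 + u ^ 2) = K.+1 * r' * (a ^ 2 + 2 * (u * n)).
  by rewrite -cU; lia.
have e2 : K.+1 * r' * u ^ 2 <= K.+1 * r' * K ^ 2 by rewrite leq_mul2l leq_exp2r ?uK ?orbT.
have : u * n <= K * n by rewrite leq_mul2r uK orbT.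
clear -e1 e2 hN; lia.
Qed.

(** * Disjoint copies of [F] *)

Lemma embeds_image (VF V : finType) (F : rel VF) (g : rel V) (A : {set V}) :
  embeds F g A -> exists I : {set V}, [/\ I \subset A, #|I| <= #|VF| & embeds F g I].
Proof.
move=> [f [fI fF fA]]; exists (f @: setT); split.
- by apply/subsetP => _ /imsetP[x _ ->].
- by rewrite -cardsT leq_imset_card.
- by exists f; split=> // x; apply: imset_f.
Qed.

Lemma embeds_copiesS (VF V : finType) (F : rel VF) (g : rel V) (k : nat) (A B : {set V}) :
  embeds F g A -> embeds (copies k F) g B -> [disjoint A & B] ->
  embeds (copies k.+1 F) g (A :|: B).
Proof.
move=> [f [fI fF fA]] [h [hI hF hB]] AB.
pose e (p : 'I_k.+1 * VF) := if unlift ord0 p.1 is Some j then h (j, p.2) else f p.2.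
have fh x p : f x = h p -> False.
  by move=> fhE; have := disjointFr AB (fA x); rewrite fhE hB.
exists e; split.
- move=> [i x] [j y]; rewrite /e /=.
  case: unliftP => [i' ->|->]; case: unliftP => [j' ->|->] //.
  + by move/hI=> [-> ->].
  + by move=> /esym/fh.
  + by move=> /fh.
  + by move/fI->.
- move=> [i x] [j y]; rewrite /copies /e /= => /andP[/eqP-> Fxy].
  case: unliftP => [j' _|_]; last exact: fF.
  by apply: hF; rewrite /copies /= eqxx.
- by move=> [i x]; rewrite /e inE /=; case: unliftP => [j _|_]; rewrite ?fA ?hB ?orbT.
Qed.

(** Copies are disjoint, so at most one of them uses [v]; that one is dropped, or copy 0 if none
    does. *)
Lemma embeds_copies_lift (VF V : finType) (F : rel VF) (g : rel V) (k : nat) (v : V) :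
  embeds (copies k.+1 F) g setT -> embeds (copies k F) g (~: [set v]).
Proof.
move=> [f [fI fF _]].
have [i0 hi0] : exists i0 : 'I_k.+1, forall i x, i != i0 -> f (i, x) != v.
  have [/existsP[[i y] /= /eqP fv]|/existsPn nv] := boolP [exists p, f p == v].
    exists i => j x; apply: contra => /eqP; rewrite -fv => /fI [-> _] //.
  by exists ord0 => i x _; apply: nv.
exists (fun p => f (lift i0 p.1, p.2)); split.
- by move=> [i x] [j y] /fI/eqP; rewrite xpair_eqE /= => /andP[/eqP/lift_inj-> /eqP->].
- by move=> [i x] [j y] /= /andP[/eqP /= -> Fxy]; apply: fF; rewrite /copies /= eqxx.
- by move=> [i x]; rewrite !inE hi0 //= eq_sym neq_lift.
Qed.

Lemma embeds_copies1 (VF V : finType) (F : rel VF) (g : rel V) (k : nat) (A : {set V}) :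
  embeds (copies k.+1 F) g A -> embeds F g A.
Proof.
move=> [f [fI fF fA]]; exists (fun x => f (ord0, x)); split=> //.
  by move=> x y /fI[].
by move=> x y Fxy; apply/fF/andP.
Qed.

Lemma copies1_embeds (VF V : finType) (F : rel VF) (g : rel V) (A : {set V}) :
  embeds F g A -> embeds (copies 1 F) g A.
Proof.
move=> [f [fI fF fA]]; exists (fun p => f p.2); split=> // [[i x] [j y] /fI /= ->|].
  by rewrite !ord1.
by move=> [i x] [j y] /andP[_]; apply: fF.
Qed.

Lemma contains_copies1 (VF V : finType) (F : rel VF) (g : rel V) :
  contains (copies 1 F) g = contains F g.
Proof.
by apply/containsP/containsP; [apply: embeds_copies1 | apply: copies1_embeds].
Qed.

Lemma ex_copies1 (VF : finType) (F : rel VF) (n : nat) : ex (copies 1 F) n = ex F n.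
Proof. by apply: eq_bigl => g; rewrite contains_copies1. Qed.

(** Greedy choice: deleting the image of one copy of [F] leaves a set with one disjoint copy fewer
    to exclude. *)
Lemma copies_cover (VF V : finType) (F : rel VF) (g : rel V) (k : nat) (A : {set V}) :
  ~ embeds (copies k.+1 F) g A ->
  exists2 U : {set V}, #|U| <= k * #|VF| & ~ embeds F g (A :\: U).
Proof.
elim: k A => [|k IH] A nA.
  exists set0; rewrite ?cards0 // setD0; apply: contra_not nA.
  exact: copies1_embeds.
have [/embeds_image[I [IA cI FI]]|nF] := embeds_dec F g A; last first.
  by exists set0; rewrite ?cards0 // setD0.
have [|U cU nU] := IH (A :\: I).
  apply: contra_not nA => kF.
  apply: embedsS (embeds_copiesS FI kF _).
    by rewrite subUset IA subsetDl.
  by rewrite disjoint_sym disjoints_subset setDE subsetIr.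
exists (I :|: U); last by rewrite -setDDl.
by apply: leq_trans (leq_card_setU _ _) _; rewrite mulSn leq_add.
Qed.

(** * Deleting and joining a vertex in extremal graphs *)

Lemma edges_lift (n : nat) (g : rel 'I_n.+1) (v : 'I_n.+1) :
  irreflexive g -> symmetric g ->
  edges g = edges (fun x y => g (lift v x) (lift v y)) + nb g setT v.
Proof.
move=> gI gS; apply/eqP; rewrite -(eqn_pmul2l (isT : 0 < 2)) mulnDr; apply/eqP.
rewrite -!vol_edges //.
rewrite (vol_setD1 gI gS (in_setT v)) (vol_imset g _ (@lift_inj _ v)).
congr (vol _ _ + _); apply/setP => x; rewrite !inE andbT; apply/idP/imsetP.
  by case: (unliftP v x) => [j ->|->]; [exists j | rewrite eqxx].
by move=> [j _ ->]; rewrite eq_sym neq_lift.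
Qed.

Section Extremal.
Variables (VF : finType) (F : rel VF) (x0 y0 : VF).
Hypotheses (F0 : F x0 y0).

Lemma ex_le_copies (k n : nat) : ex F n <= ex (copies k.+1 F) n.
Proof.
have [g [gI gS nF <-]] := ex_attained n F0.
by apply: edges_ex => //; apply: contra_not nF; apply: embeds_copies1.
Qed.

(** A new vertex joined to an extremal graph destroys at most one copy when deleted again, so the
    join cannot contain k+2 copies. *)
Lemma ex_copies_join (k n : nat) :
  n + ex (copies k.+1 F) n <= ex (copies k.+2 F) n.+1.
Proof.
have F0' : copies k.+1 F (ord0, x0) (ord0, y0) by rewrite /copies F0.
have [g [gI gS nF <-]] := ex_attained n F0'.
pose J : rel 'I_n.+1 := fun x y =>
  match unlift ord0 x, unlift ord0 y with
  | Some i, Some j => g i j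
  | None, None => false
  | _, _ => true
  end.
have JI : irreflexive J by move=> x; rewrite /J; case: unlift.
have JS : symmetric J.
  by move=> x y; rewrite /J; case: (unlift ord0 x); case: (unlift ord0 y).
have -> : n + edges g = edges J.
  rewrite (edges_lift ord0 JI JS) addnC; congr (_ + _).
    by apply: eq_card => p; rewrite !inE /J !liftK.
  rewrite nb_card -[LHS](card_ord n) -cardsT -(card_imset _ (@lift_inj _ ord0)).
  apply: eq_card => x; rewrite !inE /J unlift_none.
  case: unliftP => [j ->|->]; first by rewrite imset_f.
  by apply/imsetP => -[j _ /eqP]; rewrite (negbTE (neq_lift _ _)).
apply: edges_ex => // /(@embeds_copies_lift _ _ _ _ _ ord0) JF; apply: nF.
have [f [fI fF fA]] := JF.
have [h hE] : exists h, forall p, f p = lift ord0 (h p).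
  apply: (@fin_all_exists _ (fun=> 'I_n) (fun p i => f p = lift ord0 i)) => p.
  have := fA p; rewrite !inE.
  by case: (unliftP ord0 (f p)) => [j -> _|->]; [exists j | rewrite eqxx].
exists h; split=> // [p p' e|p p' /fF]; first by apply: fI; rewrite !hE e.
by rewrite !hE /J !liftK.
Qed.
End Extremal.

(** The inductive step: a heavy vertex of an extremal graph is an apex, and deleting it leaves an
    extremal graph for one copy fewer. *)
Lemma extremal_apex (VF : finType) (F : rel VF) (r C k : nat) : 1 < r ->
  (forall n, ex F n <= edges (turan n r) + C /\ edges (turan n r) <= ex F n + C) ->
  (exists x y, F x y) ->
  exists n0, forall (n : nat) (G : rel 'I_n.+1), n0 <= n ->
    irreflexive G -> symmetric G -> ~ embeds (copies k.+2 F) G setT ->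
    edges G = ex (copies k.+2 F) n.+1 ->
    exists v, [/\ forall y, v != y -> G v y,
      ~ embeds (copies k.+1 F) (fun x y => G (lift v x) (lift v y)) setT &
      edges (fun x y => G (lift v x) (lift v y)) = ex (copies k.+1 F) n].
Proof.
move=> r1 hC [x0 [y0 F0]]; have r0 := ltnW r1.
have [D hD] := ex_quadratic r0 hC.
have hD1 n : 2 * r * ex F n <= (r - 1) * n ^ 2 + D by case: (hD n).
have Fcone := embeds_cone r0 (fun n => (hC n).1).
(* [K] bounds both a set whose deletion destroys all copies of [F] and the vertex set of k+1
   disjoint copies. *)
pose K := k.+1 * #|VF|; pose D' := D + r.+1.
have hD' n : 2 * r * ex F n <= (r - 1) * n ^ 2 + D'.
  by apply: leq_trans (hD1 n) _; rewrite /D' addnA leq_addr.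
have [N1 HN1] := heavy_vertex_exists K r0 hD'.
have [N2 HN2] := @heavy_vertex_embeds _ F r _ K K.+1 D r0 (ltn0Sn _) (ltn0Sn _) hD1 Fcone.
exists (N1 + N2 + D') => n G hn GI GS nF Gex.
(* Joining a vertex to an [F]-extremal graph on [n] vertices gives 2r e(G) >= (r-1)n^2 + 2rn - D;
   rewriting this in n+1 costs the constant r+1 put into [D']. *)
have dense : (r - 1) * n.+1 ^ 2 + 2 * n.+1 <= r * vol G setT + D'.
  have := leq_trans (leq_add (leqnn n) (ex_le_copies F0 k n)) (ex_copies_join F0 k n).
  rewrite -Gex vol_edges // => /(leq_mul (leqnn (2 * r))).
  have [_] := hD n; rewrite /D'; move: (edges G) (ex F n) => e e' h1 h2.
  have [r' rE] : exists r', r = r'.+1 by exists r.-1; lia.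
  move: h1 h2; rewrite rE subn1 /=; lia.
have [U cU nU] := copies_cover nF.
rewrite setTD in nU.
have [||v hv] := HN1 _ G U GI GS _ _ cU nU; rewrite ?card_ord //; first lia.
rewrite card_ord in hv.
have vF (W : {set 'I_n.+1}) : #|W| <= K -> v \notin W -> embeds F G (~: W).
  by move=> cW vW; apply: (HN2 _ G v) => //; rewrite card_ord //; lia.
(* k+1 copies avoiding [v] occupy a set [W] of at most [K] vertices; [vF] supplies one more copy
   outside [W]. *)
have nkF : ~ embeds (copies k.+1 F) (fun x y => G (lift v x) (lift v y)) setT.
  move=> kF; apply: nF.
  have : embeds (copies k.+1 F) G (~: [set v]).
    apply: (@embeds_comp _ _ _ _ _ _ setT _ (lift v)) kF => // [x y _ _|x _].
      exact: lift_inj.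
    by rewrite !inE eq_sym neq_lift.
  move=> /embeds_image[W [Wv cW kFW]].
  apply: embedsS (subsetT _) (embeds_copiesS (vF W _ _) kFW _).
  - by rewrite card_prod card_ord in cW.
  - by apply/negP => /(subsetP Wv); rewrite !inE eqxx.
  - by rewrite disjoints_subset.
have Gv := edges_lift v GI GS.
have le1 : edges (fun x y => G (lift v x) (lift v y)) <= ex (copies k.+1 F) n.
  by apply: edges_ex.
have nbE : nb G setT v = #|[set y in ~: [set v] | G v y]|.
  rewrite nb_card; apply: eq_card => y; rewrite !inE.
  by case: eqP => [->|//]; rewrite GI.
have le2 : nb G setT v <= n.
  by rewrite nbE -nb_card (leq_trans (nb_le _ _ _)) // cardsC1 card_ord.
(* e(G) = e(G-v) + deg v <= ex((k+1)F, n) + n <= ex((k+2)F, n+1) = e(G), so both summands attain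
   their bounds. *)
have ge := ex_copies_join F0 k n.
exists v; split=> //; last by lia.
have : [set y in ~: [set v] | G v y] = ~: [set v].
  apply/eqP; rewrite eqEcard cardsC1 card_ord -nbE; apply/andP; split; last by lia.
  by apply/subsetP => y; rewrite inE => /andP[].
move=> /setP e y vy; have := e y; rewrite !inE eq_sym vy => //.
Qed.

Theorem theorem1p1 (r k : nat) (VF : finType) (F : rel VF)
    (hFirr : irreflexive F) (hFsym : symmetric F) :
  2 <= r -> 1 <= k ->
  (exists C : nat, forall n : nat,
      ex F n <= edges (turan n r) + C /\ edges (turan n r) <= ex F n + C) ->
  exists n0 : nat, forall n : nat, n0 <= n ->
    forall G : rel 'I_n, irreflexive G -> symmetric G ->
      ~~ contains (copies k F) G ->
      edges G = ex (copies k F) n ->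
      exists (S : {set 'I_n}) (h : 'I_(n - k.-1) -> 'I_n),
        [/\ #|S| = k.-1, injective h, (forall i, h i \notin S),
            (forall x y, x \in S -> x != y -> G x y)
          & ~~ contains F (fun i j => G (h i) (h j)) /\ edges (fun i j => G (h i) (h j)) = ex F (n - k.-1)].
Proof.
move=> r1 k1 [C hC].
(* For edgeless [F], [ex F n] vanishes for large [n], against quadratic growth with r >= 2; n = |VF|
   + D + 1 already gives the contradiction. *)
have hF : exists x y, F x y.
  have [/existsP[x /existsP[y Fxy]]|/existsPn nF] := boolP [exists x, exists y, F x y].
    by exists x, y.
  have [D hD] := ex_quadratic (ltnW r1) hC.
  have [_] := hD (#|VF| + D.+1); rewrite ex_edgeless ?leq_addr //.
    rewrite muln0 add0n leqNgt => /negP[]; rewrite -mulnn mulnA.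
    apply: leq_trans (leq_mul _ (leq_addl #|VF| D.+1)); first by rewrite -{1}[D.+1]mul1n.
    by rewrite muln_gt0 subn_gt0 r1 addnS.
  by move=> x y; have /existsPn := nF x.
case: k k1 => // k _; elim: k => [|k [n0 IH]].
  (* One copy: [S] is empty and [h] is the identity, once [n - 0], which occurs in the type of [h],
     is replaced by [n]. *)
  exists 0 => n _ G _ _; rewrite contains_copies1 ex_copies1 /=; move: (subn0 n).
  move: (n - 0) => m mn; subst m => nF Gex; exists set0, id; split=> //.
  - by rewrite cards0.
  - by move=> i; rewrite inE.
  - by move=> x y; rewrite inE.
have [n1 H1] := extremal_apex k r1 hC hF.
exists (n0 + n1).+1 => -[//|n]; rewrite ltnS => hn G GI GS /containsP nF Gex.
have [|v [Gv nF' Gex']] := H1 n G _ GI GS nF Gex; first by lia.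
have [|||S [h [cS hI hS GSx [nFh hex]]]] :=
  IH n _ (fun x y => G (lift v x) (lift v y)) _ _ (introN (containsP _ _) nF') Gex'.
- by lia.
- by move=> x; apply: GI.
- by move=> x y; apply: GS.
(* The domain of [h] is unchanged, since [n.+1 - k.+1] and [n - k] are convertible. *)
exists (v |: lift v @: S), (lift v \o h); split.
- rewrite cardsU1 card_imset ?cS; last exact: lift_inj.
  by case: imsetP => // -[x _ /eqP]; rewrite (negbTE (neq_lift _ _)).
- by apply: inj_comp hI; apply: lift_inj.
- move=> i; rewrite !inE /= eq_sym (negbTE (neq_lift _ _)) /=.
  by rewrite mem_imset //; apply: lift_inj.
- move=> x y; rewrite !inE => /orP[/eqP->|/imsetP[x' x'S ->]]; first exact: Gv.
  case: (unliftP v y) => [y' ->|->] xy; last by rewrite GS; apply: Gv; rewrite eq_sym.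
  by apply: GSx => //; apply: contra xy => /eqP->.
- by split.
Qed.
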